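(* Let $m\geq1$ be an integer and $p\in[0,1)$. The probability-generating function of $T_{m,p}$ is $$G_{T_{m,p}}(z):=\sum_{n=0}^\infty\mathbb{P}(T_{m,p}=n)\,z^n=\left[\sum_{\ell=0}^m\binom{m-m/z}{\ell}(-1)^\ell\left(\frac1{1-p}\right)^\ell\right]^{-1},$$ as an identity of formal power series in $z$. Moreover, as analytic expressions, both sides agree on an open ball around the origin of radius strictly greater than $1$, where at $z=0$ the right-hand side is defined by its limit $0$.
   Context: For an integer $m\geq 1$, let $\{C_n\}_{n\geq 1}$ be uniformly distributed on $[m]=\{1,\dots,m\}$ and $\{U_n\}_{n\geq1}$ be uniformly distributed on $(0,1)$, with the whole family $\{U_n,C_n\}_{n\geq1}$ independent. For $i\in[m]$ and $n>0$ let $L(i,n)=\sup\{1\leq k\leq n : C_k=i\}$ (with $\sup\emptyset=-\infty$). For $p\in[0,1)$ the clumsy coupon collection time is $$T_{m,p}=\inf\{n>0 : L(i,n)>0 \text{ and } U_{L(i,n)}\leq 1-p \text{ for all } i\in[m]\}.$$ For an integer $\ell\geq0$, $\binom{z}{\ell}=\frac{1}{\ell!}z(z-1)\cdots(z-\ell+1)$ is a polynomial in $z$, with $\binom z0=1$. The bracketed expression is a rational function of $z$ whose reciprocal is expanded as a power series at $z=0$. *)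

(* Defs.v *)
From HB Require Import structures.
From mathcomp Require Import all_boot all_order all_algebra finmap complex.
From mathcomp Require Import all_classical all_reals all_analysis.

Set Implicit Arguments.
Unset Strict Implicit.
Unset Printing Implicit Defensive.
Import Order.TTheory GRing.Theory Num.Theory numFieldNormedType.Exports.

Local Open Scope classical_set_scope.
Local Open Scope ring_scope.

Definition mutually_independent {d : measure_display} {T : measurableType d}
    {R : realType} (P : probability T R) (I : choiceType)
    (F : I -> set (set T)) :=
  forall (J : {fset I}) (E : I -> set T),
    (forall i, i \in J -> F i (E i)) ->
    P (\bigcap_(i in [set` J]) E i) = (\prod_(i <- J) P (E i))%E.

(* The variables are numbered from 1, so the 0th ones are left out. *)
Definition independent_from1 {d : measure_display} {T : measurableType d}
    {R : realType} (P : probability T R)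
    (U : nat -> {RV P >-> R}) (C : nat -> {RV P >-> nat}) :=
  mutually_independent P (fun k : (nat + nat)%type =>
    match k with
    | inl n => g_sigma_algebra_preimage (U n.+1)
    | inr n => g_sigma_algebra_preimage (C n.+1)
    end).

Definition uniform_1_to {d : measure_display} {T : measurableType d}
    {R : realType} (P : probability T R) (m : nat) (X : {RV P >-> nat}) :=
  forall i, (1 <= i <= m)%N -> P (X @^-1` [set i]) = (m%:R^-1)%:E.

(* [uniform_prob] lives on the closed interval [0, 1], which differs from
   (0, 1) by a null set.  The laws are compared on measurable sets only. *)
Definition uniform_on_01 {d : measure_display} {T : measurableType d}
    {R : realType} (P : probability T R) (X : {RV P >-> R}) :=
  forall A : set R, measurable A ->
    distribution P X A = uniform_prob (@ltr01 R) A.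

(* L(i, n).  As the competing indices k are positive, the value 0 stands for
   sup set0 = -oo; it is ruled out by the test L(i, n) > 0. *)
Definition last_time {T : Type} (C : nat -> T -> nat) (i n : nat) (w : T)
    : nat :=
  (\max_(1 <= k < n.+1 | C k w == i) k)%N.

(* The infimum of the empty set is +oo. *)
Definition clumsy_time {T : Type} {R : realType} (m : nat) (p : R)
    (U : nat -> T -> R) (C : nat -> T -> nat) (w : T) : \bar R :=
  ereal_inf [set (n%:R%:E : \bar R) | n in [set n : nat | (0 < n)%N /\
    forall i, (1 <= i <= m)%N ->
      (0 < last_time C i n w)%N /\ U (last_time C i n w) w <= 1 - p]].

Definition clumsy_pmf {d : measure_display} {T : measurableType d}
    {R : realType} (P : probability T R) (m : nat) (p : R)
    (U : nat -> T -> R) (C : nat -> T -> nat) (n : nat) : R :=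
  fine (P [set w | clumsy_time m p U C w = n%:R%:E]).

Definition gbinom {K : fieldType} (x : K) (l : nat) : K :=
  (l`!)%:R^-1 * \prod_(j < l) (x - j%:R).

(* Over an arbitrary field, so as to serve both as a rational function
   (z the indeterminate) and as a function of a complex variable. *)
Definition bracket {K : fieldType} (m : nat) (p z : K) : K :=
  \sum_(l < m.+1) gbinom (m%:R - m%:R / z) l * (-1) ^+ l * (1 / (1 - p)) ^+ l.

(* a is the coefficient sequence of the power series expansion of f at 0:
   f = N / D with D(0) != 0, and D * (sum_n a_n X^n) = N in K[[X]]. *)
Definition power_series_expansion {K : fieldType} (f : {fraction {poly K}})
    (a : nat -> K) :=
  exists N D : {poly K},
    [/\ D.[0] != 0,
        f = tofrac N / tofrac D
      & forall n, \sum_(k < n.+1) D`_k * a (n - k)%N = N`_n].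

Definition bracket_rational {R : realType} (m : nat) (p : R) :
    {fraction {poly R}} :=
  bracket m (tofrac p%:P) (tofrac 'X).

Definition bracket_complex {R : realType} (m : nat) (p : R) (z : R[i]^o) : R[i]^o :=
  bracket m (p%:C)%C (z : R[i]).

(* Main.v *)
(* Let S_n be the set of coupons whose last draw up to time n is good, so that
   T is the first n with S_n = [m].  Drawing acts triangularly on the functions
   S |-> 'C(#|S|, l): the mean of 'C(#|S'|, l) after one draw is a combination
   of 'C(#|S|, l) and 'C(#|S|, l - 1).  Solving the resulting two-term
   recurrence gives coefficients c_l(z), with c_0 = 1, for which
   h(S) = \sum_l c_l(z) 'C(#|S|, l) makes z^n h(S_n) a martingale up to T;
   moreover h([m]) is the bracket B(z).  Hence, exactly and in any field,
     B(z) \sum_(n <= N) P(T = n) z^n + z^N E[h(S_N); T > N] = h(set0) = 1.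
   Multiplied by z^m this is an identity of polynomials, which yields the formal
   statement by comparing coefficients.  As P(T > N) decays geometrically, the
   remainder vanishes on a disc of radius > 1, which gives both the analytic
   identity and the absence of zeros of B there. *)

Require Import Defs.
From HB Require Import structures.
From mathcomp Require Import all_boot all_order all_algebra finmap complex.
From mathcomp Require Import all_classical all_reals all_analysis.
From mathcomp Require Import ring lra.

Import Order.TTheory GRing.Theory Num.Theory numFieldNormedType.Exports.

Local Open Scope ring_scope.

(** * The absorbed Markov chain of sets of good coupons *)

Definition coupon_step {m : nat} (S : {set 'I_m}) (x : 'I_m.+1 * bool) :
    {set 'I_m} :=
  [set i : 'I_m | if val x.1 == i.+1 then x.2 else i \in S]%SET.

(** Index 0 is a null draw, which changes nothing; the coupon [i : 'I_m] carries the number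
    [i.+1]. *)
Definition draw_prob {R : fieldType} (m : nat) (p : R)
    (x : 'I_m.+1 * bool) : R :=
  (if val x.1 == 0%N then 0 else m%:R^-1) * (if x.2 then 1 - p else p).

(* The probability that the set of good coupons is S at time n and has not been
   complete at any earlier time; mass that reaches [m] is absorbed and counted
   only at its arrival time. *)
Fixpoint state_mass {R : fieldType} (m : nat) (p : R) (n : nat)
    (S : {set 'I_m}) : R :=
  if n is n'.+1 then
    \sum_(S0 | S0 != [set: 'I_m]%SET) \sum_x
      state_mass m p n' S0 * draw_prob m p x * (coupon_step S0 x == S)%:R
  else (S == finset.set0)%:R.

(** This is E[f(S_n); T > n], not divided by P(T > n), so that one-step relations stay linear. *)
Definition running_mean {R : fieldType} (m : nat) (p : R) (n : nat)
    (f : {set 'I_m} -> R) : R :=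
  \sum_(S | S != [set: 'I_m]%SET) state_mass m p n S * f S.

(** Conditioning on the last draw; the mass absorbed in [m] at time n + 1 leaves the running mean
    and is added back. *)
Lemma running_meanS {R : fieldType} (m : nat) (p : R) (n : nat)
    (f : {set 'I_m} -> R) :
  state_mass m p n.+1 [set: 'I_m]%SET * f [set: 'I_m]%SET +
    running_mean m p n.+1 f =
  running_mean m p n (fun S => \sum_x draw_prob m p x * f (coupon_step S x)).
Proof.
transitivity (\sum_S state_mass m p n.+1 S * f S).
  by rewrite [RHS](bigD1 [set: 'I_m]%SET).
rewrite /running_mean /=.
under eq_bigr do rewrite mulr_suml.
rewrite exchange_big /=; apply: eq_bigr => S0 _.
under eq_bigr do rewrite mulr_suml.
rewrite exchange_big /= mulr_sumr; apply: eq_bigr => x _.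
rewrite (bigD1 (coupon_step S0 x)) //= eqxx mulr1 big1 ?addr0 ?mulrA //.
by move=> S /negbTE; rewrite eq_sym => ->; rewrite mulr0 mul0r.
Qed.

Lemma eq_running_mean {R : fieldType} (m : nat) (p : R) (n : nat)
    (f g : {set 'I_m} -> R) :
  (forall S, S != [set: 'I_m]%SET -> f S = g S) ->
  running_mean m p n f = running_mean m p n g.
Proof. by move=> fg; apply: eq_bigr => S /fg ->. Qed.

Lemma running_meanD {R : fieldType} (m : nat) (p : R) (n : nat)
    (f g : {set 'I_m} -> R) :
  running_mean m p n (fun S => f S + g S) =
  running_mean m p n f + running_mean m p n g.
Proof. by rewrite -big_split; apply: eq_bigr => S _; rewrite mulrDr. Qed.

Lemma running_meanZ {R : fieldType} (m : nat) (p : R) (n : nat) (a : R)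
    (f : {set 'I_m} -> R) :
  running_mean m p n (fun S => a * f S) = a * running_mean m p n f.
Proof. by rewrite mulr_sumr; apply: eq_bigr => S _; rewrite mulrCA. Qed.

Lemma card_lt_full {m : nat} {S : {set 'I_m}} :
  S != [set: 'I_m]%SET -> (#|S| < m)%N.
Proof.
move=> SN; rewrite -[ltnRHS]card_ord -cardsT ltnNge.
by apply: contra SN; rewrite eqEcard finset.subsetT.
Qed.

Lemma coupon_step_hit {m : nat} (S : {set 'I_m}) (i : 'I_m) :
  coupon_step S (lift ord0 i, true) = (i |: S)%SET /\
  coupon_step S (lift ord0 i, false) = (S :\ i)%SET.
Proof.
by split; apply/setP => j; rewrite !inE /= eqSS [_ == _ :> nat]eq_sym;
  rewrite -[_ == _ :> nat]/(j == i); case: eqP.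
Qed.

(** Each of the #|S| good coupons is kept or lost when drawn, and each of the others is gained or
    left out. *)
Lemma sum_draw_card {R : fieldType} (m : nat) (p : R) (S : {set 'I_m})
    (F : nat -> R) :
  \sum_x draw_prob m p x * F #|coupon_step S x| =
  m%:R^-1 * (#|S|%:R * ((1 - p) * F #|S| + p * F #|S|.-1) +
    (m - #|S|)%:R * ((1 - p) * F #|S|.+1 + p * F #|S|)).
Proof.
transitivity (\sum_(c < m.+1) \sum_(b : bool)
    draw_prob m p (c, b) * F #|coupon_step S (c, b)|).
  by rewrite pair_big; apply: eq_bigr => -[].
rewrite big_ord_recl [X in X + _]big1 ?add0r; last first.
  by move=> b _; rewrite /draw_prob eqxx !mul0r.
rewrite (eq_bigr (fun i => m%:R^-1 * (if i \in S
   then (1 - p) * F #|S| + p * F #|S|.-1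
   else (1 - p) * F #|S|.+1 + p * F #|S|))); last first.
  move=> i _; rewrite big_bool /draw_prob /= -!mulrA -mulrDr.
  have [-> ->] := coupon_step_hit S i; congr (_ * _).
  rewrite cardsU1 (cardsD1 i S) /=; case: (boolP (i \in S)) => //= iS.
rewrite -mulr_sumr; congr (_ * _).
rewrite (bigID (fun i => i \in S)) /= ; congr (_ + _).
  rewrite (eq_bigr (fun=> (1 - p) * F #|S| + p * F #|S|.-1)); last by move=> i ->.
  by rewrite sumr_const mulr_natl.
rewrite (eq_bigr (fun=> (1 - p) * F #|S|.+1 + p * F #|S|)); last first.
  by move=> i /negbTE ->.
rewrite sumr_const mulr_natl -[m in (m - _)%N]card_ord; congr (_ *+ _).
by rewrite -(cardC (mem S)) addKn; apply: eq_card => i; rewrite !inE.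
Qed.

(** The triangular action: the identities [E1] and [E2] absorb the factors #|S| and m - #|S|, which
    leaves coefficients independent of [S]. *)
Lemma sum_draw_bin {R : fieldType} (m : nat) (p : R) (S : {set 'I_m}) (l : nat) :
  m%:R != 0 :> R -> (l < m)%N ->
  \sum_x draw_prob m p x * 'C(#|coupon_step S x|, l.+1)%:R =
  (1 - l.+1%:R / m%:R) * 'C(#|S|, l.+1)%:R +
    (1 - p) / m%:R * (m - l)%:R * 'C(#|S|, l)%:R.
Proof.
move=> m0 lm; rewrite (sum_draw_card m p S (fun k => 'C(k, l.+1)%:R)).
have kS : (#|S| <= m)%N by rewrite -[leqRHS]card_ord max_card.
rewrite !natrB ?(ltnW lm) //.
move: #|S| kS => k km.
(* At k = 0 the truncated [k.-1] is harmless: both sides vanish. *)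
have E1 : k%:R * 'C(k.-1, l.+1)%:R = (k%:R - l.+1%:R) * 'C(k, l.+1)%:R :> R.
  case: k {km} => [|k]; first by rewrite !bin0n /= mul0r mulr0.
  rewrite -natrM; have := mul_bin_diag k.+1 l => h.
  have : (k.+1 * 'C(k, l.+1) + l.+1 * 'C(k.+1, l.+1) = k.+1 * 'C(k.+1, l.+1))%N.
    by rewrite -h [in RHS]binS mulnDr addnC.
  move=> /(congr1 (fun n => n%:R : R)); rewrite natrD !natrM => e.
  by rewrite mulrBl -e addrK.
(* [mul_bin_left] subtracts in [nat], so k < l is treated apart; both binomials are then 0. *)
have E2 : l.+1%:R * 'C(k, l.+1)%:R = (k%:R - l%:R) * 'C(k, l)%:R :> R.
  have := mul_bin_left k l.
  case: (leqP l k) => [lk|kl].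
    by move/(congr1 (fun n => n%:R : R)); rewrite !natrM natrB.
  by rewrite !bin_small ?mulr0 // ltnW.
have -> : 'C(k.+1, l.+1)%:R = 'C(k, l.+1)%:R + 'C(k, l)%:R :> R by rewrite binS natrD.
apply: (mulfI m0); rewrite mulrA mulfV // mul1r.
transitivity (k%:R * ((1 - p) * 'C(k, l.+1)%:R) + p * (k%:R * 'C(k.-1, l.+1)%:R)
   + (m%:R - k%:R) *
     ((1 - p) * ('C(k, l.+1)%:R + 'C(k, l)%:R) + p * 'C(k, l.+1)%:R)).
  by ring.
rewrite E1.
transitivity ((m%:R - l.+1%:R) * 'C(k, l.+1)%:R +
    (1 - p) * (l.+1%:R * 'C(k, l.+1)%:R) +
    (1 - p) * (m%:R - k%:R) * 'C(k, l)%:R).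
  by ring.
rewrite E2; field; exact: m0.
Qed.

Lemma sum_draw_prob {R : fieldType} (m : nat) (p : R) :
  m%:R != 0 :> R -> \sum_x draw_prob m p x = 1.
Proof.
move=> m0; under eq_bigr do rewrite -[draw_prob _ _ _]mulr1.
rewrite (sum_draw_card m p finset.set0 (fun=> 1)) cards0 subn0 mul0r add0r.
by rewrite !mulr1 subrK mulr1 mulVf.
Qed.

(** * The bracket, its polynomial numerator and the martingale identity *)

Lemma gbinomS {F : fieldType} (x : F) (l : nat) :
  gbinom x l.+1 = gbinom x l * (x - l%:R) / l.+1%:R.
Proof.
by rewrite /gbinom big_ord_recr factS natrM invfM /=; ring.
Qed.

(** The coefficients c_l(z) of h; the division by 'C(m, l) makes h([m]) equal to the bracket. *)
Definition bracket_coef {F : fieldType} (m : nat) (p z : F) (l : nat) : F :=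
  gbinom (m%:R - m%:R / z) l * (-1) ^+ l * (1 / (1 - p)) ^+ l / 'C(m, l)%:R.

(** For l <= m this represents z^m c_l(z): each of the l factors m - m/z - j takes one power of z,
    and m - l powers remain. *)
Definition bracket_coef_num {F : fieldType} (m : nat) (p : F) (l : nat) :
    {poly F} :=
  ((l`!)%:R^-1 * (-1) ^+ l * (1 / (1 - p)) ^+ l / 'C(m, l)%:R) *:
    ('X^(m - l) * \prod_(j < l) ((m%:R - j%:R) *: 'X - m%:R%:P)).

Definition bracket_num {F : fieldType} (m : nat) (p : F) : {poly F} :=
  \sum_(l < m.+1) 'C(m, l)%:R *: bracket_coef_num m p l.

Section Bracket.
(** Probabilities lie in [R] and z in [F], later the fraction field of polynomials or the complex
    field. As [R] has characteristic 0, positive integers are nonzero in [F]. *)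
Variables (R : numFieldType) (F : fieldType) (f : {rmorphism R -> F}).
Variables (m : nat) (p : R).
Hypothesis p1 : p != 1.

Let natf_neq0 (n : nat) : (0 < n)%N -> n%:R != 0 :> F.
Proof. by move=> n0; rewrite -(rmorph_nat f) fmorph_eq0 pnatr_eq0 -lt0n. Qed.

Let f1p_neq0 : 1 - f p != 0.
Proof. by rewrite -(rmorph1 f) -rmorphB fmorph_eq0 subr_eq0 eq_sym. Qed.

Lemma bracket_coefE (z : F) :
  bracket m (f p) z = \sum_(l < m.+1) bracket_coef m (f p) z l * 'C(m, l)%:R.
Proof.
by apply: eq_bigr => l _; rewrite /bracket_coef divfK // natf_neq0 // bin_gt0 -ltnS.
Qed.

Lemma bracket_coef0 (z : F) : bracket_coef m (f p) z 0 = 1.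
Proof.
by rewrite /bracket_coef /gbinom big_ord0 fact0 bin0 !expr0 invr1 !mulr1.
Qed.

(** This matches the coefficients of 'C(#|S|, l) in z E[h(S')] = h(S). It holds because c_(l+1) /
    c_l = - (m - m/z - l) / ((1 - p)(m - l)). *)
Lemma bracket_coefS (z : F) (l : nat) : z != 0 -> (l < m)%N ->
  z * ((1 - l%:R / m%:R) * bracket_coef m (f p) z l +
       (1 - f p) / m%:R * (m - l)%:R * bracket_coef m (f p) z l.+1) =
  bracket_coef m (f p) z l.
Proof.
move=> z0 lm.
have m0 : m%:R != 0 :> F by apply: natf_neq0; apply: leq_ltn_trans lm.
have ml0 : m%:R - l%:R != 0 :> F by rewrite -natrB ?(ltnW lm) // natf_neq0 // subn_gt0.
have b0 : 'C(m, l)%:R != 0 :> F by rewrite natf_neq0 // bin_gt0 ltnW.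
have l1 : l.+1%:R != 0 :> F by exact: natf_neq0.
have bS : 'C(m, l.+1)%:R = 'C(m, l)%:R * (m%:R - l%:R) / l.+1%:R :> F.
  apply: (mulIf l1); rewrite divfK // -natrB ?(ltnW lm) // -!natrM.
  by rewrite mulnC mul_bin_left mulnC.
rewrite /bracket_coef gbinomS bS natrB ?(ltnW lm) // !exprS.
move: (gbinom _ l) ((-1) ^+ l) ((1 / _) ^+ l) => g s e.
by field; rewrite b0 nat1r l1 ml0 f1p_neq0 z0 m0.
Qed.

(** The top binomial lives on [m] only, hence the sums over l < m below. *)
Lemma running_mean_bin_full (n : nat) :
  running_mean m p n (fun S => 'C(#|S|, m)%:R) = 0.
Proof.
by apply: big1 => S /card_lt_full Sm; rewrite bin_small // mulr0.
Qed.

(** One step of the martingale: mass absorbed at time n + 1 contributes h([m]), which is the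
    bracket. *)
Lemma sum_bracket_coef_step (z : F) (n : nat) : (0 < m)%N -> z != 0 ->
  z * (f (state_mass m p n.+1 [set: 'I_m]%SET) * bracket m (f p) z +
    \sum_(l < m) bracket_coef m (f p) z l *
      f (running_mean m p n.+1 (fun S => 'C(#|S|, l)%:R))) =
  \sum_(l < m) bracket_coef m (f p) z l *
      f (running_mean m p n (fun S => 'C(#|S|, l)%:R)).
Proof.
move=> m0 z0; rewrite bracket_coefE.
set g := state_mass _ _ _ _; set c := bracket_coef m _ z.
pose Q k l := running_mean m p k (fun S : {set 'I_m} => 'C(#|S|, l)%:R).
have m0R : m%:R != 0 :> R by rewrite pnatr_eq0 -lt0n.
(* Degree 0 is conservation of mass; the higher degrees [HS] come from the triangular action. *)
have H0 : g + Q n.+1 0 = Q n 0.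
  rewrite /Q /g -[X in X + _]mulr1.
  have := running_meanS m p n (fun S => 'C(#|S|, 0)%:R); rewrite bin0 => ->.
  apply: eq_running_mean => S _; under eq_bigr do rewrite bin0 mulr1.
  by rewrite bin0 sum_draw_prob.
have HS (l : 'I_m) : g * 'C(m, l.+1)%:R + Q n.+1 l.+1 =
    (1 - l.+1%:R / m%:R) * Q n l.+1 + (1 - p) / m%:R * (m - l)%:R * Q n l.
  have := running_meanS m p n (fun S => 'C(#|S|, l.+1)%:R).
  rewrite cardsT card_ord => ->; rewrite -!running_meanZ -running_meanD.
  by apply: eq_running_mean => S _; rewrite sum_draw_bin.
(* The index l = m may be included, since its running mean is 0; the absorbed mass then joins the
   sum term by term. *)
transitivity (z * \sum_(l < m.+1) c l * (f g * 'C(m, l)%:R + f (Q n.+1 l))).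
  congr (_ * _); under [RHS]eq_bigr do rewrite mulrDr.
  rewrite big_split /=; congr (_ + _).
    by rewrite mulr_sumr; apply: eq_bigr => l _; ring.
  by rewrite big_ord_recr /= /Q running_mean_bin_full rmorph0 mulr0 addr0.
transitivity (z * (\sum_(l < m.+1) c l * ((1 - l%:R / m%:R) * f (Q n l)) +
   \sum_(l < m) c l.+1 * ((1 - f p) / m%:R * (m - l)%:R * f (Q n l)))).
  congr (_ * _); rewrite !big_ord_recl -addrA; congr (_ + _).
    by rewrite mul0r subr0 mul1r bin0 mulr1 -rmorphD H0.
  rewrite -big_split; apply: eq_bigr => l _ /=; rewrite -mulrDr; congr (_ * _).
  rewrite -(rmorph_nat f) -rmorphM -rmorphD HS.
  by rewrite !(rmorphB, rmorphD, rmorphM, fmorphV, rmorph1, rmorph_nat).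
rewrite big_ord_recr /= {2}/Q running_mean_bin_full rmorph0 !mulr0 addr0.
rewrite -big_split mulr_sumr; apply: eq_bigr => l _ /=.
by rewrite -[c l in RHS]bracket_coefS // -/c /Q; ring.
Qed.

(** The one-step relation is iterated from the empty set, where only l = 0 survives and h = c_0 =
    1. *)
Lemma bracket_martingale (z : F) (n : nat) : (0 < m)%N -> z != 0 ->
  bracket m (f p) z *
    \sum_(k < n.+1) f (state_mass m p k [set: 'I_m]%SET) * z ^+ k +
  z ^+ n * \sum_(l < m) bracket_coef m (f p) z l *
    f (running_mean m p n (fun S => 'C(#|S|, l)%:R)) = 1.
Proof.
move=> m0 z0; elim: n => [|n IHn].
  have TN0 : ([set: 'I_m]%SET == finset.set0) = false.
    by apply/negbTE; rewrite -card_gt0 cardsT card_ord.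
  rewrite big_ord1 /= TN0 rmorph0 mul0r mulr0 add0r expr0 mul1r.
  rewrite (eq_bigr (fun l : 'I_m => (val l == 0)%:R)); last first.
    move=> l _; rewrite /running_mean (bigD1 finset.set0) /=; last first.
      by rewrite eq_sym TN0.
    rewrite eqxx mul1r big1 ?addr0; last first.
      by move=> S /andP[_ /negbTE ->]; rewrite mul0r.
    rewrite cards0; case: l => -[|l] lm /=; last by rewrite bin0n rmorph0 mulr0.
    by rewrite bracket_coef0 bin0 rmorph1 mulr1.
  by case: (m) m0 => // k _; rewrite big_ord_recl big1 ?addr0.
rewrite -[RHS]IHn big_ord_recr /= mulrDr -addrA; congr (_ + _).
rewrite -(sum_bracket_coef_step _ n m0 z0) exprS; ring.
Qed.

Lemma horner_bracket_coef_num (z : F) (l : nat) : z != 0 -> (l <= m)%N ->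
  (map_poly f (bracket_coef_num m p l)).[z] = z ^+ m * bracket_coef m (f p) z l.
Proof.
move=> z0 lm; rewrite /bracket_coef_num map_polyZ hornerZ.
rewrite [map_poly f (_ * _)]rmorphM hornerM /= map_polyXn hornerXn.
rewrite [map_poly f _]rmorph_prod horner_prod /=.
under eq_bigr do rewrite rmorphB /= map_polyZ map_polyX map_polyC !hornerE /=.
rewrite /bracket_coef /gbinom.
rewrite !(rmorphM, rmorphXn, fmorphV, rmorphD, rmorphN, rmorph1, rmorph_nat).
under eq_bigr do rewrite rmorphB !rmorph_nat.
rewrite -[in z ^+ m](subnK lm) exprD.
have -> : \prod_(i < l) ((m%:R - i%:R) * z - m%:R) =
   z ^+ l * \prod_(i < l) (m%:R - m%:R / z - i%:R).
  rewrite -[in z ^+ l](card_ord l) -prodr_const -big_split.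
  by apply: eq_bigr => i _ /=; field.
by ring.
Qed.

Lemma horner_bracket_num (z : F) : z != 0 ->
  (map_poly f (bracket_num m p)).[z] = z ^+ m * bracket m (f p) z.
Proof.
move=> z0; rewrite bracket_coefE mulr_sumr rmorph_sum horner_sum.
apply: eq_bigr => l _ /=; rewrite map_polyZ hornerZ rmorph_nat.
by rewrite horner_bracket_coef_num -1?ltnS // mulrC mulrA.
Qed.

Lemma horner_bracket_num_martingale (z : F) (n : nat) : (0 < m)%N -> z != 0 ->
  (map_poly f (bracket_num m p *
     \sum_(k < n.+1) state_mass m p k [set: 'I_m]%SET *: 'X^k +
   'X^n * \sum_(l < m) running_mean m p n (fun S => 'C(#|S|, l)%:R) *:
     bracket_coef_num m p l)).[z] = z ^+ m.
Proof.
move=> m0 z0; rewrite rmorphD !rmorphM !hornerE /= horner_bracket_num //.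
rewrite map_polyXn hornerXn -[RHS]mulr1 -[in RHS](bracket_martingale z n m0 z0).
rewrite mulrDr mulrA; congr (_ + _).
  congr (_ * _); rewrite rmorph_sum horner_sum; apply: eq_bigr => k _ /=.
  by rewrite map_polyZ hornerZ map_polyXn hornerXn.
rewrite mulrCA; congr (_ * _).
rewrite rmorph_sum horner_sum mulr_sumr; apply: eq_bigr => l _ /=.
rewrite map_polyZ hornerZ horner_bracket_coef_num //; last exact: ltnW.
by ring.
Qed.

End Bracket.

(** At 0 only the term l = m survives, and its product is (-m)^m. *)
Lemma bracket_num0 {R : numFieldType} (m : nat) (p : R) : p != 1 ->
  (bracket_num m p).[0] != 0.
Proof.
move=> p1; rewrite horner_sum big_ord_recr big1 /=; last first.
  move=> l _; rewrite !hornerZ hornerM hornerXn expr0n subn_eq0 leqNgt ltn_ord.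
  by rewrite mul0r !mulr0.
rewrite !hornerZ hornerM hornerXn subnn expr0 horner_prod binn add0r !mul1r.
rewrite !(mulf_eq0, invr_eq0, expf_eq0, oner_eq0, oppr_eq0, subr_eq0) /=.
rewrite pnatr_eq0 gtn_eqF ?fact_gt0 // [1 == p]eq_sym (negbTE p1) !andbF /=.
apply/prodf_neq0 => j _; rewrite !hornerE oppr_eq0 pnatr_eq0.
by case: (m) j => // -[].
Qed.

Lemma tofrac_map_poly {R : fieldType} (D : {poly R}) :
  (map_poly (@tofrac {poly R} \o polyC) D).[tofrac 'X] = tofrac D.
Proof. by rewrite map_poly_comp horner_map /= -/(D \Po 'X) comp_polyXr. Qed.

(** Evaluation at the indeterminate of the fraction field is injective on polynomials, so the
    identity there is one of polynomials. *)
Lemma bracket_num_martingale {R : numFieldType} (m : nat) (p : R) (n : nat) :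
  (0 < m)%N -> p != 1 ->
  bracket_num m p * \sum_(k < n.+1) state_mass m p k [set: 'I_m]%SET *: 'X^k +
  'X^n * \sum_(l < m) running_mean m p n (fun S => 'C(#|S|, l)%:R) *:
    bracket_coef_num m p l = 'X^m.
Proof.
move=> m0 p1; apply/eqP; rewrite -tofrac_eq; apply/eqP.
have X0 : tofrac 'X != 0 :> {fraction {poly R}} by rewrite tofrac_eq0 polyX_eq0.
rewrite -[LHS]tofrac_map_poly rmorphXn /=.
exact: (horner_bracket_num_martingale _ _ _ _ _ p1 _ n m0 X0).
Qed.

(** * Geometric decay of P(T > n) *)

Section Decay.
Variables (R : realFieldType) (m : nat) (p : R).
Hypotheses (m0 : (0 < m)%N) (p01 : 0 <= p < 1).

Lemma draw_prob_ge0 x : 0 <= draw_prob m p x.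
Proof.
case/andP: p01 => p0 p1; rewrite /draw_prob mulr_ge0 //; case: ifP => // _.
  by rewrite subr_ge0 ltW.
Qed.

Lemma state_mass_ge0 n S : 0 <= state_mass m p n S.
Proof.
elim: n S => [|n IHn] S /=; first by case: eqP.
do 2 (apply: sumr_ge0 => ? _); apply: mulr_ge0 => //.
by apply: mulr_ge0; [exact: IHn | exact: draw_prob_ge0].
Qed.

Lemma ler_running_mean n (f g : {set 'I_m} -> R) :
  (forall S, S != [set: 'I_m]%SET -> f S <= g S) ->
  running_mean m p n f <= running_mean m p n g.
Proof.
by move=> fg; apply: ler_sum => S /fg; apply: ler_wpM2l; exact: state_mass_ge0.
Qed.

(* Each draw improves an unfinished collection with probability at least
   (1 - p) / m, which doubles c ^ #|S| in the mean: the function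
   K - c ^ #|S| drops by at least 1, hence is contracted by 1 - K^-1. *)
Lemma running_mean_decay : exists rho M : R, 0 < rho < 1 /\
  forall n, running_mean m p n (fun=> 1) <= M * rho ^+ n.
Proof.
case/andP: p01 => p0 p1.
have q0 : 0 < 1 - p by rewrite subr_gt0.
have mR : 0 < m%:R :> R by rewrite ltr0n.
have m1R : 1 <= m%:R :> R by rewrite ler1n.
(* Chosen so that (1 - p) c^(k+1) = 2 m c^k: one missing coupon alone, drawn with probability 1/m,
   brings 2 c^k to the mean. *)
pose c : R := 2 * m%:R / (1 - p).
have c1 : 1 <= c by rewrite /c ler_pdivlMr // mul1r; lra.
have c0 : 0 <= c by apply: le_trans c1.
pose K : R := c ^+ m + 1.
have K1 : 1 < K by rewrite /K ltrDr exprn_gt0 // (lt_le_trans _ c1).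
have K0 : 0 < K by apply: lt_trans K1.
pose h (S : {set 'I_m}) : R := K - c ^+ #|S|.
have h1 S : 1 <= h S.
  rewrite /h /K addrAC ler_wpDl // subr_ge0 ler_weXn2l //.
  by rewrite -[leqRHS]card_ord max_card.
have hK S : h S <= K by rewrite gerBl exprn_ge0.
have drift S : S != [set: 'I_m]%SET ->
    \sum_x draw_prob m p x * h (coupon_step S x) <= (1 - K^-1) * h S.
  move=> /card_lt_full km.
  (* A drop by 1 suffices: h <= K gives h - 1 <= (1 - 1/K) h. *)
  apply: (@le_trans _ _ (h S - 1)); last first.
    by rewrite mulrBl mul1r lerD2l lerN2 mulrC ler_pdivrMr // mul1r.
  rewrite (sum_draw_card m p S (fun k => K - c ^+ k)) /h natrB ?(ltnW km) //.
  have kR : #|S|%:R + 1 <= m%:R :> R by rewrite natr1 ler_nat.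
  move: #|S| km kR => k km kR.
  have k0 : 0 <= k%:R :> R by [].
  have ck1 : 1 <= c ^+ k by rewrite exprn_ege1.
  have ckp : 0 <= c ^+ k.-1 by rewrite exprn_ge0.
  have ckS : (1 - p) * c ^+ k.+1 = 2 * m%:R * c ^+ k.
    by rewrite exprS /c; field; rewrite gt_eqF.
  rewrite mulrC ler_pdivrMr //.
  have -> : k%:R * ((1 - p) * (K - c ^+ k) + p * (K - c ^+ k.-1)) +
     (m%:R - k%:R) * ((1 - p) * (K - c ^+ k.+1) + p * (K - c ^+ k)) =
     K * m%:R - (k%:R * ((1 - p) * c ^+ k + p * c ^+ k.-1) +
       (m%:R - k%:R) * ((1 - p) * c ^+ k.+1 + p * c ^+ k)) by ring.
  have -> : (K - c ^+ k - 1) * m%:R = K * m%:R - (c ^+ k + 1) * m%:R by ring.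
  rewrite lerD2l lerN2 ckS.
  have A1 : 0 <= k%:R * ((1 - p) * c ^+ k + p * c ^+ k.-1).
    by rewrite mulr_ge0 // addr_ge0 // mulr_ge0 // ?ltW // (lt_le_trans _ ck1).
  (* At least one coupon is missing, so m - k >= 1. With c^k >= 1 ([A3]) the total is at least m
     (c^k + 1). *)
  have A2 : 2 * m%:R * c ^+ k <= (m%:R - k%:R) * (2 * m%:R * c ^+ k + p * c ^+ k).
    rewrite -[leLHS]mul1r; apply: ler_pM => //.
    - by rewrite !mulr_ge0 // exprn_ge0.
    - by rewrite lerBrDl.
    - by rewrite lerDl mulr_ge0 // exprn_ge0.
  have A3 : 1 * m%:R <= c ^+ k * m%:R by rewrite ler_pM2r.
  by lra.
exists (1 - K^-1), K; split.
  by rewrite subr_gt0 invf_lt1 // K1 ltrBlDr ltrDl invr_gt0.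
move=> n; apply: (@le_trans _ _ (running_mean m p n h)).
  by apply: ler_running_mean.
elim: n => [|n IHn].
  rewrite expr0 mulr1 /running_mean (bigD1 finset.set0) /=; last first.
    by rewrite eq_sym -card_gt0 cardsT card_ord.
  rewrite eqxx mul1r big1 ?addr0 //.
  by move=> S /andP[_ /negbTE ->]; rewrite mul0r.
rewrite exprS mulrCA.
apply: (@le_trans _ _ ((1 - K^-1) * running_mean m p n h)); last first.
  by rewrite ler_wpM2l // subr_ge0 invf_le1 // ltW.
rewrite -running_meanZ; apply: le_trans (ler_running_mean _ _ _ drift).
by rewrite -running_meanS lerDr mulr_ge0 ?state_mass_ge0 // (le_trans _ (h1 _)).
Qed.

End Decay.

Local Open Scope classical_set_scope.

(** * Good coupons along a sample path and the event T = n *)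

Lemma total_probability {d : measure_display} {T : measurableType d}
    {R : realType} (P : probability T R) (I : finType) (f : T -> I)
    (E : set T) :
  measurable E -> (forall i, measurable (f @^-1` [set i])) ->
  P E = (\sum_i P (E `&` f @^-1` [set i]))%E.
Proof.
move=> mE mf; rewrite -[in LHS](setIT E).
have -> : [set: T] = \bigcup_(i in [set` enum I]) f @^-1` [set i].
  by apply/esym/seteqP; split=> // w _; exists (f w) => //=; rewrite mem_enum.
rewrite setI_bigcupr measure_fin_bigcup.
- by rewrite -fsbig_seq ?enum_uniq // big_enum.
- exact: finite_seq.
- by move=> i j _ _ [w [[_ fi] [_ fj]]]; rewrite -fi fj.
- by move=> i _; apply: measurableI.
Qed.

Section Collection.
Context {T : Type} {R : realType}.
Variables (m : nat) (p : R) (U : nat -> T -> R) (C : nat -> T -> nat).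

Definition good_coupons (n : nat) (w : T) : {set 'I_m} :=
  [set i : 'I_m | (0 < last_time C i.+1 n w)%N &&
                  (U (last_time C i.+1 n w) w <= 1 - p)]%SET.

(* Draws outside of [1, m], which have probability 0, are sent to 0 and leave
   the collection unchanged. *)
Definition draw (n : nat) (w : T) : 'I_m.+1 * bool :=
  (inord (if (C n.+1 w <= m)%N then C n.+1 w else 0%N), U n.+1 w <= 1 - p).

(** The event whose probability is to be [state_mass m p n S]; for S = [m] it is T = n. *)
Definition running_at (n : nat) (S : {set 'I_m}) : set T :=
  [set w | good_coupons n w = S /\
    forall k, (k < n)%N -> good_coupons k w != [set: 'I_m]%SET].

Lemma last_timeS i n w :
  last_time C i n.+1 w = if C n.+1 w == i then n.+1 else last_time C i n w.
Proof.
rewrite /last_time big_mkcond big_nat_recr //= -big_mkcond /=.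
case: ifP => _; last by rewrite maxn0.
apply/maxn_idPr/bigmax_leqP_seq => k; rewrite mem_index_iota => /andP[_ kn] _.
exact: ltnW.
Qed.

Lemma good_coupons0 w : good_coupons 0 w = finset.set0.
Proof. by apply/setP => i; rewrite !inE /last_time big_geq. Qed.

(** The drawn coupon gets last time n + 1, hence the quality of that draw; a draw above m touches no
    coupon and is encoded by 0. *)
Lemma good_couponsS n w :
  good_coupons n.+1 w = coupon_step (good_coupons n w) (draw n w).
Proof.
apply/setP => i; rewrite !inE last_timeS /draw /= inordK; last by case: ifP.
case: (leqP (C n.+1 w) m) => [_|mC]; first by case: eqP.
by rewrite gtn_eqF //; apply: leq_trans mC; rewrite !ltnS.
Qed.

Lemma good_coupons_fullE n w :
  good_coupons n w = [set: 'I_m]%SET <->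
  forall i, (1 <= i <= m)%N ->
    (0 < last_time C i n w)%N /\ U (last_time C i n w) w <= 1 - p.
Proof.
split=> [/setP full [//|i] im | full].
  by apply/andP; have := full (Ordinal im); rewrite !inE.
by apply/setP => i; rewrite !inE; apply/andP/full/ltn_ord.
Qed.

(** An infimum of natural numbers is attained unless the set is empty. Time 0, excluded from the
    infimum, is never complete because m > 0. *)
Lemma clumsy_timeE (n : nat) : (0 < m)%N ->
  [set w | clumsy_time m p U C w = n%:R%:E] = running_at n [set: 'I_m]%SET.
Proof.
move=> m0; apply/seteqP; split=> w; rewrite /running_at /clumsy_time /=;
    set Z := [set _ | _]%classic => /=.
  pose ok k := (0 < k)%N && (good_coupons k w == [set: 'I_m]%SET).
  have ZP k : Z k <-> ok k.
    split=> [[k0 h]|/andP[k0 /eqP h]]; last by split; [|exact/good_coupons_fullE].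
    by apply/andP; split=> //; apply/eqP/good_coupons_fullE.
  have [exk | nexk] := pselect (exists k, ok k); last first.
    (* With no complete time the infimum is +oo, which is not the finite n. *)
    suff -> : Z = set0 by rewrite image_set0 ereal_inf0.
    by apply/seteqP; split=> // k /ZP okk; apply: nexk; exists k.
  case: (ex_minnP exk) => k okk kmin infn.
  have kn : k = n.
    apply/eqP; rewrite -(eqr_nat R) -eqe -infn; apply/eqP/le_anti/andP; split.
      by apply: le_ereal_inf_tmp => _ [j /ZP okj <-]; rewrite lee_fin ler_nat kmin.
    by apply: ereal_inf_lbound; exists k => //; apply/ZP.
  rewrite -kn; case/andP: (okk) => _ /eqP; split=> // j jk.
  case: j jk => [|j] jk.
    by rewrite good_coupons0 eq_sym -card_gt0 cardsT card_ord.
  apply/negP => okj; have := kmin j.+1; rewrite /ok okj => /(_ isT).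
  by rewrite leqNgt jk.
case=> full nfull; apply/le_anti/andP; split.
  apply: ereal_inf_lbound; exists n => //; split; last exact/good_coupons_fullE.
  case: n full {nfull} => // /setP /(_ (Ordinal m0)).
  by rewrite good_coupons0 !inE.
apply: le_ereal_inf_tmp => _ [j [j0 /good_coupons_fullE okj] <-].
rewrite lee_fin ler_nat leqNgt; apply/negP => /nfull.
by rewrite okj eqxx.
Qed.

End Collection.

Lemma uniform_prob_le {R : realType} (q : R) : 0 <= q <= 1 ->
  uniform_prob (@ltr01 R) [set x | x <= q] = q%:E.
Proof.
case/andP=> q0 q1; rewrite /uniform_prob integral_uniform_pdf.
have -> : [set x : R | x <= q] `&` `[0, 1]%classic = `[0, q]%classic.
  apply/seteqP; split=> x /=; rewrite !in_itv /=.
    by case=> xq /andP[-> _].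
  by case/andP=> x0 xq; rewrite xq x0 (le_trans xq).
rewrite (eq_integral (fun=> 1%:E)); last first.
  move=> x; rewrite inE /= in_itv /= => /andP[x0 xq].
  by rewrite /uniform_pdf x0 (le_trans xq) //= subr0 invr1.
rewrite integral_cst //= lebesgue_measure_itv /= mul1e lte_fin oppr0 adde0.
by move: q0; rewrite le_eqVlt => /predU1P[<-|->]; rewrite ?ltxx.
Qed.

(** * The law of the chain under independence *)

Section Law.
Context {d : measure_display} {T : measurableType d} {R : realType}.
Variables (P : probability T R) (m : nat) (p : R).
Variables (U : nat -> {RV P >-> R}) (C : nat -> {RV P >-> nat}).
Hypotheses (m0 : (0 < m)%N) (p01 : 0 <= p < 1).
Hypothesis CP : forall n, (1 <= n)%N -> uniform_1_to m (C n).
Hypothesis UP : forall n, (1 <= n)%N -> uniform_on_01 (U n).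
Hypothesis UC : independent_from1 U C.

(** With [quality_fiber], this splits a draw event into an event of C and an event of U, to which
    independence applies. *)
Let coupon_fiber (c : 'I_m.+1) : set nat :=
  [set k | inord (if (k <= m)%N then k else 0%N) = c].

Let quality_fiber (b : bool) : set R := [set u | (u <= 1 - p) = b].

Let measurable_quality_fiber b : measurable (quality_fiber b).
Proof.
have -> : quality_fiber b =
    (if b then `]-oo, 1 - p] else `]1 - p, +oo[)%classic.
  apply/seteqP; split=> u; rewrite /quality_fiber; case: b => /=;
    rewrite in_itv /= ?andbT => //; first by move/negbT; rewrite -ltNge.
  by move=> h; rewrite leNgt h.
by case: b.
Qed.

Let draw_fiber (n : nat) (x : 'I_m.+1 * bool) :
  draw m p U C n @^-1` [set x] =
  U n.+1 @^-1` quality_fiber x.2 `&` C n.+1 @^-1` coupon_fiber x.1.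
Proof.
case: x => c b; apply/seteqP; split=> w; rewrite /draw /=.
  by case=> <- <-; split.
by case=> hU hC; congr (_, _).
Qed.

Let measurable_U n A : measurable A -> measurable (U n @^-1` A).
Proof. by move=> mA; rewrite -[X in measurable X]setTI; apply: measurable_funP. Qed.

Let measurable_C n A : measurable (C n @^-1` A).
Proof. by rewrite -[X in measurable X]setTI; apply: measurable_funP. Qed.

Let measurable_draw n x : measurable (draw m p U C n @^-1` [set x]).
Proof.
rewrite draw_fiber; apply: measurableI; last exact: measurable_C.
exact: measurable_U.
Qed.

Let prob_quality n b :
  P (U n.+1 @^-1` quality_fiber b) = (if b then 1 - p else p)%:E.
Proof.
have [p0 p1] := andP p01.
have Ptrue : P (U n.+1 @^-1` quality_fiber true) = (1 - p)%:E.
  rewrite -[LHS]/(distribution P (U n.+1) _) UP // uniform_prob_le //.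
  by rewrite subr_ge0 gerBl ltW.
case: b => //.
have -> : quality_fiber false = ~` quality_fiber true.
  by apply/seteqP; split=> u; rewrite /quality_fiber /=; case: (u <= 1 - p).
rewrite -preimage_setC probability_setC; last exact: measurable_U.
by rewrite Ptrue -EFinB opprB addrC subrK.
Qed.

(** The hypothesis gives the law on [1, m] only; these m values already have total mass 1, so the
    fiber of 0 is null. *)
Let prob_coupon n c :
  P (C n.+1 @^-1` coupon_fiber c) = (if val c == 0%N then 0 else m%:R^-1)%:E.
Proof.
have pos (i : 'I_m) :
    P (C n.+1 @^-1` coupon_fiber (lift ord0 i)) = (m%:R^-1)%:E.
  rewrite -(@CP n.+1 _ i.+1) ?ltn_ord //; congr (P _).
  apply/seteqP; split=> w; rewrite /coupon_fiber /=.
    by move/(congr1 val); rewrite /= inordK; [case: ifP => // _ -> | case: ifP].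
  by move=> ->; rewrite ltn_ord; apply/val_inj; rewrite /= inordK // ltnS.
case: (unliftP ord0 c) => [i ->|->]; first by rewrite pos.
rewrite eqxx.
have := total_probability P _
  (fun w => inord (if (C n.+1 w <= m)%N then C n.+1 w else 0%N) : 'I_m.+1)
  _ (@measurableT _ T) (fun i => measurable_C n.+1 (coupon_fiber i)).
rewrite probability_setT big_ord_recl.
under eq_bigr do rewrite setTI -/(coupon_fiber _) pos.
rewrite sumEFin setTI => /esym.
rewrite sumr_const card_ord -[_ *+ m]mulr_natl mulfV; last by rewrite pnatr_eq0 -lt0n.
rewrite -/(coupon_fiber _).
have : P (C n.+1 @^-1` coupon_fiber ord0) \is a fin_num by exact: fin_num_measure.
move=> /fineK; set x := fine _; move=> <-.
by rewrite -EFinD => -[h]; congr (_%:E); apply: (addIr 1); rewrite h add0r.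
Qed.

Lemma prob_draws (N : nat) (y : nat -> 'I_m.+1 * bool) :
  P [set w | forall j, (j < N)%N -> draw m p U C j w = y j] =
  (\prod_(0 <= j < N) draw_prob m p (y j))%:E.
Proof.
(* Independence concerns one family indexed by a sum type; the first N indices of both copies are
   used. *)
pose s : seq (nat + nat)%type := map inl (iota 0 N) ++ map inr (iota 0 N).
pose E (k : (nat + nat)%type) := match k with
  | inl j => U j.+1 @^-1` quality_fiber (y j).2
  | inr j => C j.+1 @^-1` coupon_fiber (y j).1 end.
have us : uniq s.
  rewrite cat_uniq !map_inj_uniq ?iota_uniq ?andbT /=; try by move=> ? ? [].
  by apply/hasPn => _ /mapP[j _ ->]; apply/negP => /mapP[].
pose J := [fset k in s]%fset.
have memJ k : (k \in J) = (k \in s).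
  by apply/imfsetP/idP => [[x xs ->]|ks]; [|exists k].
have perm_s : perm_eq J s by apply: uniq_perm.
have := UC J E.
have -> : \bigcap_(i in [set` J]) E i =
    [set w | forall j, (j < N)%N -> draw m p U C j w = y j].
  apply/seteqP; split=> w h.
    move=> j jN; rewrite -[_ = _]/((draw m p U C j @^-1` [set y j]) w) draw_fiber.
    by split; [apply: (h (inl j))|apply: (h (inr j))];
      rewrite /= memJ mem_cat map_f ?orbT ?mem_iota.
  have {}h j : (j < N)%N -> E (inl j) w /\ E (inr j) w.
    by move=> /h; rewrite -[_ = _]/((draw m p U C j @^-1` [set y j]) w) draw_fiber.
  move=> k; rewrite /= memJ mem_cat => /orP[] /mapP[j];
    by rewrite mem_iota => /h[? ?] ->.
move=> ->; last first.
  move=> [] j _ /=; last by exists (coupon_fiber (y j).1) => //; rewrite setTI.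
  by exists (quality_fiber (y j).2); rewrite ?setTI.
rewrite (perm_big _ perm_s) big_cat !big_map /=.
under eq_bigr do rewrite prob_quality.
under [X in (_ * X)%E]eq_bigr do rewrite prob_coupon.
by rewrite !prodEFin -EFinM mulrC -big_split /= /index_iota subn0.
Qed.

(** Fixing the state and the draw at time n trades one step of the chain for one more prescribed
    draw. *)
Let running_atS (n N : nat) (S : {set 'I_m}) (y : nat -> 'I_m.+1 * bool)
    (S0 : {set 'I_m}) (x : 'I_m.+1 * bool) : (n < N)%N ->
  running_at m p U C n.+1 S `&`
    [set w | forall j, (n < j < N)%N -> draw m p U C j w = y j] `&`
    (fun w => (good_coupons m p U C n w, draw m p U C n w)) @^-1` [set (S0, x)] =
  if (S0 != [set: 'I_m]%SET) && (coupon_step S0 x == S) then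
    running_at m p U C n S0 `&`
    [set w | forall j, (n <= j < N)%N ->
       draw m p U C j w = (if j == n then x else y j)]
  else set0.
Proof.
move=> nN; apply/seteqP; split=> w /=.
  move=> [[[hS hrun] hy] [hS0 hx]].
  have := hrun n (ltnSn n); rewrite hS0 => -> /=.
  rewrite -hS0 -hx -good_couponsS hS eqxx; split.
    by split=> // k kn; apply: hrun; rewrite ltnS ltnW.
  move=> j /andP[nj jN]; case: eqP => [-> //|/eqP jn]; apply: hy.
  by rewrite ltn_neqAle eq_sym jn nj.
case: ifP => // /andP[S0N /eqP stepS] [[hS0 hrun] hy].
have hx : draw m p U C n w = x by rewrite hy ?eqxx // leqnn.
rewrite hx hS0; split=> //; split; last first.
  move=> j /andP[nj jN]; rewrite hy ?(ltnW nj) //.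
  by rewrite gtn_eqF.
split; first by rewrite good_couponsS hx hS0.
by move=> k; rewrite ltnS leq_eqVlt => /predU1P[->|/hrun //]; rewrite hS0.
Qed.

Let measurable_good_coupons n S :
  measurable (good_coupons m p U C n @^-1` [set S]).
Proof.
elim: n S => [|n IHn] S.
  have [->|SN] := eqVneq S finset.set0.
    rewrite (_ : _ @^-1` _ = setT) //; apply/seteqP; split=> // w _ /=.
    exact: good_coupons0.
  rewrite (_ : _ @^-1` _ = set0) //; apply/seteqP; split=> // w /=.
  by rewrite good_coupons0 => SE; move: SN; rewrite SE eqxx.
rewrite (_ : _ @^-1` _ =
  \bigcup_(z in [set` enum [pred z : {set 'I_m} * ('I_m.+1 * bool) |
      coupon_step z.1 z.2 == S]])
    (good_coupons m p U C n @^-1` [set z.1] `&` draw m p U C n @^-1` [set z.2])).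
  by apply: fin_bigcup_measurable => [|z _]; [exact: finite_seq |];
    apply: measurableI; [exact: IHn | exact: measurable_draw].
apply/seteqP; split=> w /=; rewrite good_couponsS.
  move=> <-; exists (good_coupons m p U C n w, draw m p U C n w) => //=.
  by rewrite mem_enum inE.
by case=> -[S0 x] /=; rewrite mem_enum inE /= => /eqP <- [-> ->].
Qed.

(** Carrying prescribed future draws through the induction replaces the Markov property; the base
    case is independence of the draws. *)
Lemma prob_running_at_draws (n N : nat) (S : {set 'I_m})
    (y : nat -> 'I_m.+1 * bool) : (n <= N)%N ->
  P (running_at m p U C n S `&`
     [set w | forall j, (n <= j < N)%N -> draw m p U C j w = y j]) =
  (state_mass m p n S * \prod_(n <= j < N) draw_prob m p (y j))%:E.
Proof.
elim: n N S y => [|n IHn] N S y nN.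
  have [->|SN] := eqVneq S finset.set0.
    rewrite /= eqxx mul1r -prob_draws; congr (P _).
    apply/seteqP; split=> w /=; first by case.
    by split=> //; split=> //; exact: good_coupons0.
  rewrite /= (negbTE SN) mul0r (_ : _ `&` _ = set0) ?measure0 //.
  apply/seteqP; split=> // w [[SE _] _]; move: SN.
  by rewrite -SE good_coupons0 eqxx.
pose f w := (good_coupons m p U C n w, draw m p U C n w).
set E := (X in P X); rewrite (total_probability P _ f E).
- transitivity (\sum_S0 \sum_x P (E `&` f @^-1` [set (S0, x)]))%E.
    by rewrite pair_bigA; apply: eq_bigr => -[].
  rewrite mulr_suml -sumEFin [in RHS]big_mkcond /=; apply: eq_bigr => S0 _.
  case: ifPn => S0N; last first.
    by rewrite big1 // => x _; rewrite /E running_atS // (negbTE S0N) measure0.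
  rewrite mulr_suml -sumEFin; apply: eq_bigr => x _.
  rewrite /E running_atS // S0N /=; case: eqP => _; last first.
    by rewrite measure0 mulr0 mul0r.
  rewrite IHn ?(ltnW nN) // mulr1 big_ltn // eqxx mulrA; congr (_ * _)%:E.
  rewrite !big_nat; apply: eq_bigr => j /andP[nj _].
  by rewrite gtn_eqF.
- apply: measurableI.
    rewrite (_ : running_at _ _ _ _ _ _ =
        good_coupons m p U C n.+1 @^-1` [set S] `&`
        \bigcap_(k in [set k | (k < n.+1)%N])
          ~` (good_coupons m p U C k @^-1` [set [set: 'I_m]%SET])).
      apply: measurableI; first exact: measurable_good_coupons.
      apply: bigcap_measurableType => k _; apply: measurableC.
      exact: measurable_good_coupons.
    by apply/seteqP; split=> w [hS h]; split=> // k kn; apply/eqP; apply: h.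
  rewrite (_ : [set w | _] = \bigcap_(j in [set j | (n.+1 <= j < N)%N])
      (draw m p U C j @^-1` [set y j])); last by apply/seteqP; split.
  by apply: bigcap_measurableType => j _; exact: measurable_draw.
- move=> [S0 x]; rewrite (_ : f @^-1` _ =
    good_coupons m p U C n @^-1` [set S0] `&` draw m p U C n @^-1` [set x]).
    by apply: measurableI; [exact: measurable_good_coupons | exact: measurable_draw].
  by apply/seteqP; split=> w; rewrite /f /= => -[-> ->].
Qed.

Lemma clumsy_pmfE n : clumsy_pmf P m p U C n = state_mass m p n [set: 'I_m]%SET.
Proof.
rewrite /clumsy_pmf clumsy_timeE //.
(* For N = n no draw is prescribed, so the sequence of draws is a dummy. *)
have := prob_running_at_draws n n [set: 'I_m]%SET (fun=> (ord0, true)) (leqnn n).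
rewrite big_geq // mulr1 => h.
rewrite -[RHS]/(fine (state_mass m p n [set: 'I_m]%SET)%:E) -h; congr (fine (P _)).
rewrite -[LHS]setIT; congr (_ `&` _); apply/seteqP; split=> // w _ j.
by case/andP=> nj /(leq_ltn_trans nj); rewrite ltnn.
Qed.

End Law.

(** * The identity of formal power series *)

Lemma bracket_rationalE {R : realType} (m : nat) (p : R) : p != 1 ->
  bracket_rational m p = tofrac (bracket_num m p) / tofrac 'X^m.
Proof.
move=> p1; have X0 : tofrac 'X != 0 :> {fraction {poly R}}.
  by rewrite tofrac_eq0 polyX_eq0.
pose f : {rmorphism R -> {fraction {poly R}}} := @tofrac {poly R} \o polyC.
have e : tofrac (bracket_num m p) = tofrac 'X ^+ m * bracket_rational m p.
  by rewrite -(horner_bracket_num _ _ f m p _ X0) [RHS]tofrac_map_poly.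
have Xm0 : tofrac 'X ^+ m != 0 :> {fraction {poly R}} by exact: expf_neq0.
rewrite [in RHS]tofracXn.
have gen (F : fieldType) (a b c : F) : b != 0 -> a = b * c -> c = a / b.
  by move=> b0 ->; rewrite mulrC mulKf.
exact: gen Xm0 e.
Qed.

Lemma bracket_rational_neq0 {R : realType} (m : nat) (p : R) : p != 1 ->
  bracket_rational m p != 0.
Proof.
move=> p1; rewrite bracket_rationalE //.
have D0 : tofrac (bracket_num m p) != 0.
  rewrite tofrac_eq0; apply: contraNneq (bracket_num0 m p p1) => ->.
  by rewrite horner0.
have X0 : tofrac 'X^m != 0 :> {fraction {poly R}}.
  by rewrite tofrac_eq0 expf_neq0 // polyX_eq0.
exact: mulf_neq0 D0 (invr_neq0 X0).
Qed.

Lemma bracket_expansion {R : realType} (m : nat) (p : R) :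
  (0 < m)%N -> p != 1 ->
  power_series_expansion (bracket_rational m p)^-1
    (fun n => state_mass m p n [set: 'I_m]%SET).
Proof.
move=> m0 p1; exists 'X^m, (bracket_num m p); split.
- exact: bracket_num0.
- by rewrite bracket_rationalE // invf_div.
(* Taken at n + 1, the remainder is a multiple of X^(n+1) and does not reach the coefficient of
   X^n. *)
move=> n; rewrite -(bracket_num_martingale m p n.+1 m0 p1) coefD coefXnM ltnSn addr0.
rewrite coefM; apply: eq_bigr => k _; congr (_ * _).
have nk : (n - k < n.+2)%N by rewrite ltnS ltnW // ltnS leq_subr.
rewrite coef_sum (bigD1 (Ordinal nk)) //= coefZ coefXn eqxx mulr1.
rewrite big1 ?addr0 // => j jnk; rewrite coefZ coefXn.
suff /negbTE -> : (n - k)%N != j by rewrite mulr0.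
by apply: contra jnk => /eqP e; apply/eqP/val_inj.
Qed.

(** * Convergence on a complex disc of radius greater than 1 *)

Lemma horner_continuous {K : numFieldType} (q : {poly K}) :
  continuous (fun z : K^o => q.[z] : K^o).
Proof.
elim/poly_ind: q => [|q c IHq] z.
  rewrite (_ : (fun=> _) = fun=> 0); first exact: cst_continuous.
  by apply/funext => x; rewrite horner0.
rewrite (_ : (fun=> _) = (fun x : K^o => q.[x] * x : K^o) \+ cst (c : K^o)); last first.
  by apply/funext => x; rewrite hornerMXaddC.
apply: continuousD; last exact: cst_continuous.
apply: (@continuousM K K^o (horner q)); first exact: IHq.
exact: cvg_id.
Qed.

Lemma horner_ratio_continuous {K : numFieldType} (a b : {poly K}) (x : K^o) :
  b.[x] != 0 -> {for x, continuous (fun z : K^o => a.[z] / b.[z] : K^o)}.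
Proof.
move=> bx; apply: (@continuousM K K^o (horner a)); first exact: horner_continuous.
apply: (@continuousV K K^o (horner b)) => //; exact: horner_continuous.
Qed.

Lemma cvg_sum {K : numFieldType} (I : Type) (r : seq I) (u : I -> nat -> K^o)
    (l : I -> K^o) :
  (forall i, u i n @[n --> \oo] --> l i) ->
  (\sum_(i <- r) u i n : K^o) @[n --> \oo] --> (\sum_(i <- r) l i : K^o).
Proof.
move=> ul; elim: r => [|i r IHr].
  rewrite big_nil (_ : (fun=> _) = fun=> 0); first exact: cvg_cst.
  by apply/funext => n; rewrite big_nil.
rewrite big_cons (_ : (fun=> _) = fun n => u i n + \sum_(j <- r) u j n).
  exact: cvgD.
by apply/funext => n; rewrite big_cons.
Qed.

(** Norms on [R[i]] take values in [R[i]]; a positive bound there is real, which reduces the limit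
    to one in [R]. *)
Lemma complex_squeeze0 {R : realType} (u : nat -> R[i]^o) (a : nat -> R) :
  (forall n, `|u n| <= (a n)%:C%C) -> a n @[n --> \oo] --> (0 : R) ->
  u n @[n --> \oo] --> (0 : R[i]^o).
Proof.
move=> ua a0; apply/cvgr0Pnorm_lt => e e0.
have /complex_realP[e' ee'] : e \is Num.real by exact: gtr0_real.
have e'0 : 0 < e' by rewrite -ltcR -ee'.
have [N _ aN] := cvgr0_norm_lt a a0 e' e'0.
exists N => // n /aN h; apply: le_lt_trans (ua n) _.
by rewrite ee' ltcR (le_lt_trans _ h) // ler_norm.
Qed.

Section ComplexSeries.
Variables (R : realType) (m : nat) (p : R).
Hypotheses (m0 : (0 < m)%N) (p01 : 0 <= p < 1).

Let g (n : nat) : R := state_mass m p n [set: 'I_m]%SET.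
Let D : {poly R[i]} := map_poly (real_complex R) (bracket_num m p).

Let p1 : p != 1.
Proof. by case/andP: p01 => _ /lt_eqF ->. Qed.

Lemma bracket_complexE (z : R[i]^o) : z != 0 ->
  bracket_complex m p z = D.[z] / z ^+ m.
Proof.
move=> z0; rewrite /D (horner_bracket_num _ _ _ _ _ _ z0).
by rewrite mulrC mulKf // expf_neq0.
Qed.

(** Deduced from the polynomial identity, it also covers z = 0. *)
Lemma complex_martingale (z : R[i]) (n : nat) :
  D.[z] * \sum_(k < n.+1) (g k)%:C%C * z ^+ k +
  z ^+ n * \sum_(l < m) (running_mean m p n (fun S => 'C(#|S|, l)%:R))%:C%C *
    (map_poly (real_complex R) (bracket_coef_num m p l)).[z] = z ^+ m.
Proof.
have /(congr1 (fun q => (map_poly (real_complex R) q).[z])) :=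
  bracket_num_martingale m p n m0 p1.
rewrite rmorphD !rmorphM !hornerE /= !map_polyXn !hornerXn => <-.
congr (_ + _); congr (_ * _); rewrite rmorph_sum horner_sum; apply: eq_bigr => k _ /=.
  by rewrite map_polyZ hornerZ map_polyXn hornerXn.
by rewrite [in RHS]map_polyZ [in RHS]hornerZ.
Qed.

Lemma running_mean_binomial_cvg0 (rho M : R) (z : R[i]^o) (l : nat) :
  0 < rho -> (forall n, running_mean m p n (fun=> 1) <= M * rho ^+ n) ->
  `|z| < (rho^-1)%:C%C ->
  (z ^+ n * (running_mean m p n (fun S => 'C(#|S|, l)%:R))%:C%C : R[i]^o)
    @[n --> \oo] --> (0 : R[i]^o).
Proof.
move=> rho0 bound zr.
have /complex_realP[t zt] : `|z| \is Num.real by rewrite realE normr_ge0.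
have t0 : 0 <= t by rewrite -ler0c -zt normr_ge0.
have tr : t * rho < 1 by rewrite -ltr_pdivlMr // div1r -ltcR -zt.
(* The factor 2^m bounds 'C(#|S|, l), and |z| rho < 1 makes the geometric sequence tend to 0. *)
apply: (@complex_squeeze0 _ _ (geometric (2 ^+ m * M) (t * rho))).
  move=> n; rewrite normrM normrX zt -rmorphXn /=.
  set x := running_mean _ _ _ _.
  have x0 : 0 <= x.
    by apply: sumr_ge0 => S _; rewrite mulr_ge0 // state_mass_ge0.
  have -> : `|x%:C%C| = x%:C%C by rewrite ger0_norm // ler0c.
  rewrite -rmorphM lecR exprMn.
  have -> : 2 ^+ m * M * (t ^+ n * rho ^+ n) = t ^+ n * (2 ^+ m * (M * rho ^+ n)).
    by ring.
  rewrite ler_wpM2l ?exprn_ge0 //.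
  apply: le_trans (ler_wpM2l _ (bound n)); last by rewrite exprn_ge0.
  rewrite -running_meanZ; apply: ler_running_mean => // S _.
  rewrite mulr1 -natrX ler_nat.
  have Sm : (#|S| <= m)%N by rewrite -[leqRHS]card_ord max_card.
  apply: leq_trans (leq_pexp2l _ Sm) => //.
  case: (leqP l #|S|) => [lS|/bin_small -> //].
  have := expnDn 1 1 #|S|; rewrite addn1 => ->.
  rewrite (bigD1 (Ordinal (lS : l < #|S|.+1)%N)) //= !exp1n !muln1.
  exact: leq_addr.
by apply: cvg_geometric; rewrite ger0_norm // mulr_ge0 // ltW.
Qed.

Lemma bracket_num_partial_sum_cvg (rho M : R) (z : R[i]^o) :
  0 < rho -> (forall n, running_mean m p n (fun=> 1) <= M * rho ^+ n) ->
  `|z| < (rho^-1)%:C%C ->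
  (D.[z] * \sum_(k < n.+1) (g k)%:C%C * z ^+ k : R[i]^o) @[n --> \oo] -->
    (z ^+ m : R[i]^o).
Proof.
move=> rho0 bound zr.
pose Q n l : R[i] := (running_mean m p n (fun S => 'C(#|S|, l)%:R))%:C%C.
pose c l : R[i] := (map_poly (real_complex R) (bracket_coef_num m p l)).[z].
pose rest n : R[i]^o := \sum_(l < m) z ^+ n * Q n l * c l.
rewrite (_ : (fun=> _) = cst (z ^+ m : R[i]^o) \- rest); last first.
  apply/funext => n; rewrite /= -(complex_martingale z n).
  rewrite (_ : rest n = z ^+ n * \sum_(l < m) Q n l * c l); first by rewrite addrK.
  by rewrite mulr_sumr; apply: eq_bigr => l _; rewrite mulrA.
rewrite -[X in _ --> X](subr0 (z ^+ m : R[i]^o)).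
apply: cvgB; first exact: cvg_cst.
have -> : 0 = \sum_(l < m) 0 * c l :> R[i]^o.
  by rewrite big1 // => l _; rewrite mul0r.
apply: cvg_sum => l; apply: cvgM; last exact: cvg_cst.
exact: running_mean_binomial_cvg0 rho0 bound zr.
Qed.

(** At a zero z != 0 of [D] the products with the partial sums would all be 0, yet they tend to
    z^m. *)
Lemma bracket_num_neq0 (rho M : R) (z : R[i]^o) :
  0 < rho -> (forall n, running_mean m p n (fun=> 1) <= M * rho ^+ n) ->
  `|z| < (rho^-1)%:C%C -> D.[z] != 0.
Proof.
move=> rho0 bound zr; have [-> | z0] := eqVneq z 0.
  by rewrite /D -(rmorph0 (real_complex R)) horner_map fmorph_eq0 bracket_num0.
apply/eqP => D0; have := bracket_num_partial_sum_cvg _ _ _ rho0 bound zr.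
under eq_fun do rewrite D0 mul0r.
move=> /(cvg_unique _ (cvg_cst (0 : R[i]^o))) => /(_ (@norm_hausdorff _ _)) /esym/eqP.
by rewrite expf_eq0 (negbTE z0) andbF.
Qed.

Lemma series_cvg (rho M : R) (z : R[i]^o) :
  0 < rho -> (forall n, running_mean m p n (fun=> 1) <= M * rho ^+ n) ->
  `|z| < (rho^-1)%:C%C ->
  series (fun n => (g n)%:C%C * z ^+ n : R[i]^o) @ \oo -->
    (z ^+ m / D.[z] : R[i]^o).
Proof.
move=> rho0 bound zr; have Dz := bracket_num_neq0 _ _ _ rho0 bound zr.
(* [series] at n sums the terms below n, whereas the martingale identity includes the term n. *)
rewrite -cvg_shiftS.
rewrite (_ : [sequence _]_n =
    fun n => D.[z]^-1 * (D.[z] * \sum_(k < n.+1) (g k)%:C%C * z ^+ k)).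
  rewrite mulrC; apply: cvgM; first exact: cvg_cst.
  exact: bracket_num_partial_sum_cvg rho0 bound zr.
by apply/funext => n; rewrite mulKf // /series /= big_mkord.
Qed.

(** Off 0 the reciprocal is z^m / D(z), which is continuous at 0 and vanishes there because m >
    0. *)
Lemma bracket_complex_inv_cvg0 :
  (bracket_complex m p z)^-1 @[z --> (0 : R[i]^o)^'] --> (0 : R[i]^o).
Proof.
have D0 : D.[0] != 0.
  by rewrite /D -(rmorph0 (real_complex R)) horner_map fmorph_eq0 bracket_num0.
have lim0 : (z ^+ m / D.[z] : R[i]^o) @[z --> (0 : R[i]^o)] --> (0 : R[i]^o).
  have lim0 := horner_ratio_continuous 'X^m D (0 : R[i]^o) D0.
  rewrite (_ : (fun=> _) = fun z : R[i]^o => ('X^m).[z] / D.[z] : R[i]^o).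
    rewrite -[X in _ --> X](_ : ('X^m).[0] / D.[0] = 0 :> R[i]^o) //.
    by rewrite hornerXn expr0n gtn_eqF // mul0r.
  by apply/funext => z; rewrite hornerXn.
have {}lim0 : (z ^+ m / D.[z] : R[i]^o) @[z --> (0 : R[i]^o)^'] --> (0 : R[i]^o).
  exact: cvg_within_filter lim0.
apply: cvg_trans lim0; apply: near_eq_cvg.
have := nbhs_dnbhs_neq (0 : R[i]^o); apply: filterS => z z0.
by rewrite bracket_complexE // invf_div.
Qed.

End ComplexSeries.

Theorem theorem3p7 (R : realType) (d : measure_display) (T : measurableType d)
    (P : probability T R) (m : nat) (p : R)
    (U : nat -> {RV P >-> R}) (C : nat -> {RV P >-> nat}) :
  (1 <= m)%N ->
  0 <= p < 1 ->
  (forall n, (1 <= n)%N -> uniform_1_to m (C n)) ->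
  (forall n, (1 <= n)%N -> uniform_on_01 (U n)) ->
  independent_from1 U C ->
  let g : nat -> R := clumsy_pmf P m p U C in
  (bracket_rational m p != 0 /\
   power_series_expansion (bracket_rational m p)^-1 g) /\
  exists2 r : R, 1 < r &
    [/\ forall z : R[i]^o, ball (0 : R[i]^o) (r%:C)%C z -> z != 0 ->
          bracket_complex m p z != 0,
        (bracket_complex m p z)^-1 @[z --> (0 : R[i]^o)^'] --> (0 : R[i]^o)
      & forall z : R[i]^o, ball (0 : R[i]^o) (r%:C)%C z ->
          series (fun n => (g n)%:C%C * z ^+ n : R[i]^o) @ \oo -->
            (if z == 0 then 0 else (bracket_complex m p z)^-1 : R[i]^o)].
Proof.
move=> m0 p01 CP UP UC g.
have p1 : p != 1 by case/andP: p01 => _ /lt_eqF ->.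
have -> : g = fun n => state_mass m p n [set: 'I_m]%SET.
  by apply/funext => n; exact: clumsy_pmfE.
split.
  by split; [exact: bracket_rational_neq0 | exact: bracket_expansion].
have [rho [M [/andP[rho0 rho1] bound]]] := running_mean_decay _ _ _ m0 p01.
have inball (z : R[i]^o) :
    ball (0 : R[i]^o) (rho^-1)%:C%C z -> `|z| < (rho^-1)%:C%C.
  by rewrite -ball_normE /= sub0r normrN.
pose D := map_poly (real_complex R) (bracket_num m p).
(* The radius is the inverse of the decay rate of P(T > n). *)
exists rho^-1; first by rewrite invf_gt1.
split=> [z /inball zr z0||z /inball zr].
- rewrite bracket_complexE // mulf_neq0 ?invr_eq0 ?expf_neq0 //.
  exact: bracket_num_neq0 m0 p01 _ _ _ rho0 bound zr.
- exact: bracket_complex_inv_cvg0.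
rewrite (_ : (if _ then _ else _) = (z ^+ m / D.[z] : R[i]^o)).
  exact: series_cvg rho0 bound zr.
have [->|z0] := eqVneq z 0; last by rewrite bracket_complexE // invf_div.
by rewrite expr0n gtn_eqF // mul0r.
Qed.
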